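(* Let $G$ be a group given by an extension $$1\longrightarrow K\longrightarrow G\stackrel{\rho}{\longrightarrow} Q\longrightarrow 1$$ where $K$ is an icc group, and let $\theta:Q\longrightarrow \mathrm{Out}(K)$ be the associated homomorphism. Then $G$ is icc if and only if the induced homomorphism $\theta:FC(Q)\longrightarrow \mathrm{Out}(K)$ (the restriction of $\theta$ to $FC(Q)$) is injective.
   Context: A group is said to be icc (with infinite conjugacy classes) if it is non-trivial and all its conjugacy classes other than $\{1\}$ are infinite. For a group $H$, $FC(H)$ denotes the union of the finite conjugacy classes of $H$; it is a characteristic subgroup of $H$. $K$ is identified with its image, a normal subgroup of $G$. For $u,g\in G$, $u^g=g^{-1}ug$, and $\pi:G\to \mathrm{Aut}(K)$ is the homomorphism defined by $\pi(g)(k)=k^g$ (automorphisms being composed as right actions). $\mathrm{Out}(K)=\mathrm{Aut}(K)/\mathrm{Inn}(K)$, and the associated homomorphism $\theta:Q\to\mathrm{Out}(K)$ sends $q\in Q$ to the class of $\pi(g)$ in $\mathrm{Out}(K)$, for any $g\in G$ with $\rho(g)=q$. *)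

(* Defs.v *)
From HB Require Import structures.
From mathcomp Require Import all_boot monoid.
From mathcomp Require Import boolp classical_sets functions cardinality.
Set Implicit Arguments. Unset Strict Implicit. Unset Printing Implicit Defensive.
Local Open Scope classical_set_scope.
Local Open Scope group_scope.
Local Open Scope quotient_scope.

Definition conj_class (H : groupType) (x : H) : set H := range (conjg x).

Definition icc (H : groupType) : Prop :=
  (exists x : H, x != 1) /\
  forall x : H, x != 1 -> infinite_set (conj_class x).

Definition FC (H : groupType) : set H :=
  \bigcup_(C in range (@conj_class H) `&` finite_set) C.
Arguments FC H : clear implicits.

Section Automorphisms.
Variable K : groupType.

Definition is_aut (f : K -> K) : bool :=
  `[< {morph f : x y / x * y} /\ bijective f >].

Record Aut := MkAut { aut_fun :> K -> K; autP : is_aut aut_fun }.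
HB.instance Definition _ := [isSub for aut_fun].
HB.instance Definition _ := [Choice of Aut by <:].

Lemma aut_eqP (a b : Aut) : a =1 b -> a = b.
Proof. by move=> ab; apply/val_inj/funext. Qed.

Lemma autM (a : Aut) : {morph a : x y / x * y}.
Proof. by case: a => f /= /asboolP[]. Qed.

Lemma aut_bij (a : Aut) : bijective a.
Proof. by case: a => f /= /asboolP[]. Qed.

Lemma aut1 (a : Aut) : a 1 = 1.
Proof. by apply: (mulgI (a 1)); rewrite -autM !mulg1. Qed.

HB.instance Definition _ (a : Aut) :=
  isUMagmaMorphism.Build K K (aut_fun a) (aut1 a, @autM a).

Lemma aut_one_subproof : is_aut idfun.
Proof. by apply/asboolP; split=> //; exists idfun. Qed.
Definition aut_one : Aut := MkAut aut_one_subproof.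

Lemma aut_mul_subproof (a b : Aut) : is_aut (b \o a).
Proof.
apply/asboolP; split; last exact: bij_comp (aut_bij b) (aut_bij a).
by move=> x y /=; rewrite !autM.
Qed.
(* Right actions: in the product a * b, a is applied first. *)
Definition aut_mul (a b : Aut) : Aut := MkAut (aut_mul_subproof a b).

Lemma aut_inv_exists (a : Aut) : exists g : K -> K, cancel a g /\ cancel g a.
Proof. by case: (aut_bij a) => g; exists g. Qed.
Definition aut_inv_fun (a : Aut) : K -> K := sval (cid (aut_inv_exists a)).

Lemma aut_funK (a : Aut) : cancel a (aut_inv_fun a).
Proof. by rewrite /aut_inv_fun; case: cid => g []. Qed.

Lemma aut_inv_funK (a : Aut) : cancel (aut_inv_fun a) a.
Proof. by rewrite /aut_inv_fun; case: cid => g []. Qed.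

Lemma aut_inv_subproof (a : Aut) : is_aut (aut_inv_fun a).
Proof.
apply/asboolP; split; last by exists a; [exact: aut_inv_funK|exact: aut_funK].
move=> x y; apply: (bij_inj (aut_bij a)).
by rewrite autM !aut_inv_funK.
Qed.
Definition aut_inv (a : Aut) : Aut := MkAut (aut_inv_subproof a).

Lemma aut_mulA : associative aut_mul.
Proof. by move=> a b c; apply: aut_eqP. Qed.
Lemma aut_mul1 : left_id aut_one aut_mul.
Proof. by move=> a; apply: aut_eqP. Qed.
Lemma aut_mulr1 : right_id aut_one aut_mul.
Proof. by move=> a; apply: aut_eqP. Qed.
Lemma aut_mulV : left_inverse aut_one aut_inv aut_mul.
Proof. by move=> a; apply: aut_eqP => k /=; exact: aut_inv_funK. Qed.
Lemma aut_mulrV : right_inverse aut_one aut_inv aut_mul.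
Proof. by move=> a; apply: aut_eqP => k /=; exact: aut_funK. Qed.

HB.instance Definition _ :=
  isGroup.Build Aut aut_mulA aut_mul1 aut_mulr1 aut_mulV aut_mulrV.

Lemma aut_mulE (a b : Aut) (k : K) : (a * b) k = b (a k).
Proof. by []. Qed.

Lemma aut_oneE (k : K) : (1 : Aut) k = k.
Proof. by []. Qed.

Lemma inner_subproof (k : K) : is_aut (conjg^~ k).
Proof.
apply/asboolP; split=> [x y|]; first by rewrite conjMg.
by exists (conjg^~ k^-1) => x; rewrite ?conjgK ?conjgKV.
Qed.
Definition inner (k : K) : Aut := MkAut (inner_subproof k).

Definition Inn : set Aut := range inner.

Lemma innerM (k l : K) : inner (k * l) = inner k * inner l.
Proof. by apply: aut_eqP => x; rewrite aut_mulE /= conjgM. Qed.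

Lemma inner1 : inner 1 = 1.
Proof. by apply: aut_eqP => x; rewrite /= conjg1. Qed.

HB.instance Definition _ :=
  isUMagmaMorphism.Build K Aut inner (inner1, innerM).

Lemma innerJ (k : K) (a : Aut) : inner k ^ a = inner (a k).
Proof.
rewrite conjgE; apply: (mulgI a); rewrite mulVKg.
by apply: aut_eqP => x; rewrite !aut_mulE /= gmulfJ.
Qed.

Lemma Inn1 : Inn 1.
Proof. by exists 1; rewrite ?inner1. Qed.

Lemma InnM (a b : Aut) : Inn a -> Inn b -> Inn (a * b).
Proof. by move=> [k _ <-] [l _ <-]; exists (k * l); rewrite ?innerM. Qed.

Lemma InnV (a : Aut) : Inn a -> Inn a^-1.
Proof. by move=> [k _ <-]; exists k^-1; rewrite ?gmulfV. Qed.

Lemma InnJ (a b : Aut) : Inn a -> Inn (a ^ b).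
Proof. by move=> [k _ <-]; exists (b k); rewrite ?innerJ. Qed.

(* a and b lie in the same coset of Inn K. *)
Definition inn_rel (a b : Aut) : bool := `[< Inn (a^-1 * b) >].

Lemma inn_rel_refl : reflexive inn_rel.
Proof. by move=> a; apply/asboolP; rewrite mulVg; exact: Inn1. Qed.

Lemma inn_rel_sym : symmetric inn_rel.
Proof.
suff H a b : inn_rel a b -> inn_rel b a by move=> a b; apply/idP/idP; exact: H.
by move=> /asboolP/InnV ab; apply/asboolP; rewrite invgM invgK in ab.
Qed.

Lemma inn_rel_trans : transitive inn_rel.
Proof.
move=> b a c /asboolP ab /asboolP bc; apply/asboolP.
by have := InnM ab bc; rewrite mulgA mulgK.
Qed.

Canonical inn_equiv : equiv_rel Aut :=
  EquivRel inn_rel inn_rel_refl inn_rel_sym inn_rel_trans.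

Definition Out : Type := {eq_quot inn_rel}.
HB.instance Definition _ := Choice.on Out.
HB.instance Definition _ := EqQuotient.on Out.

Definition out_class (a : Aut) : Out := \pi_Out a.

Lemma out_classP (a b : Aut) : out_class a = out_class b <-> Inn (a^-1 * b).
Proof.
split=> [/eqmodP/asboolP//|ab]; by apply/eqmodP/asboolP.
Qed.

Lemma out_reprK : cancel repr out_class.
Proof. exact: reprK. Qed.

Definition out_one : Out := out_class 1.
Definition out_mul (x y : Out) : Out := out_class (repr x * repr y).
Definition out_inv (x : Out) : Out := out_class (repr x)^-1.

Lemma out_mul_class (a b : Aut) :
  out_mul (out_class a) (out_class b) = out_class (a * b).
Proof.
have /out_classP Ia := out_reprK (out_class a).
have /out_classP Ib := out_reprK (out_class b).
apply/out_classP; move: Ia Ib.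
set a' := repr _; set b' := repr _ => /(InnJ b') Ia Ib.
have := InnM Ia Ib; rewrite /conjg invgM.
by rewrite !mulgA mulgK.
Qed.

Lemma out_inv_class (a : Aut) : out_inv (out_class a) = out_class a^-1.
Proof.
have /out_classP := out_reprK (out_class a).
set a' := repr _ => Ia; apply/out_classP; rewrite invgK.
have /InnV := InnJ a'^-1 Ia.
by rewrite /conjg invgK -mulgA mulVKg invgM invgK.
Qed.

Lemma out_mulA : associative out_mul.
Proof.
move=> x y z; rewrite -(out_reprK x) -(out_reprK y) -(out_reprK z).
by rewrite !out_mul_class mulgA.
Qed.
Lemma out_mul1 : left_id out_one out_mul.
Proof. by move=> x; rewrite -(out_reprK x) out_mul_class mul1g. Qed.
Lemma out_mulr1 : right_id out_one out_mul.
Proof. by move=> x; rewrite -(out_reprK x) out_mul_class mulg1. Qed.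
Lemma out_mulV : left_inverse out_one out_inv out_mul.
Proof.
by move=> x; rewrite -(out_reprK x) out_inv_class out_mul_class mulVg.
Qed.
Lemma out_mulrV : right_inverse out_one out_inv out_mul.
Proof.
by move=> x; rewrite -(out_reprK x) out_inv_class out_mul_class mulgV.
Qed.

HB.instance Definition _ :=
  isGroup.Build Out out_mulA out_mul1 out_mulr1 out_mulV out_mulrV.

Lemma out_class1 : out_class 1 = 1.
Proof. by []. Qed.

Lemma out_classM : {morph out_class : a b / a * b}.
Proof. by move=> a b; rewrite -out_mul_class. Qed.

HB.instance Definition _ :=
  isUMagmaMorphism.Build Aut Out out_class (out_class1, out_classM).

End Automorphisms.
Arguments Inn K : clear implicits.

Record extension (K G Q : groupType) := Extension {
  ext_in : UMagmaMorphism.type K G;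
  ext_pr : UMagmaMorphism.type G Q;
  ext_in_inj : injective ext_in;
  ext_exact : range ext_in = [set g | ext_pr g = 1];
  ext_pr_surj : range ext_pr = setT
}.

Section Extension.
Variables (K G Q : groupType) (E : extension K G Q).
Local Notation iota := (ext_in E).
Local Notation rho := (ext_pr E).

Lemma ext_kerP (g : G) : rho g = 1 <-> exists k, iota k = g.
Proof.
have := ext_exact E => /(congr1 (fun A : set G => A g)) /= <-.
by split=> [[k _ <-]|[k <-]]; exists k.
Qed.

Lemma ext_conj_exists (g : G) (k : K) : exists l : K, iota l = iota k ^ g.
Proof.
apply/ext_kerP; rewrite gmulfJ.
have /ext_kerP -> : exists l, iota l = iota k by exists k.
by rewrite conj1g.
Qed.

(* The element k ^ g of K, for K identified with its image in G. *)
Definition ext_conj (g : G) (k : K) : K := sval (cid (ext_conj_exists g k)).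

Lemma ext_conjE (g : G) (k : K) : iota (ext_conj g k) = iota k ^ g.
Proof. by rewrite /ext_conj; case: cid. Qed.

Lemma ext_act_subproof (g : G) : is_aut (ext_conj g).
Proof.
apply/asboolP; split.
  by move=> x y; apply: (@ext_in_inj _ _ _ E); rewrite gmulfM !ext_conjE gmulfM conjMg.
by exists (ext_conj g^-1) => k; apply: (@ext_in_inj _ _ _ E);
  rewrite !ext_conjE ?conjgK ?conjgKV.
Qed.
Definition ext_act (g : G) : Aut K := MkAut (ext_act_subproof g).

Lemma ext_act1 : ext_act 1 = 1.
Proof.
apply: aut_eqP => k; apply: (@ext_in_inj _ _ _ E).
by rewrite /= ext_conjE conjg1.
Qed.

Lemma ext_actM : {morph ext_act : g h / g * h}.
Proof.
move=> g h; apply: aut_eqP => k; apply: (@ext_in_inj _ _ _ E).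
by rewrite aut_mulE /= !ext_conjE conjgM.
Qed.

HB.instance Definition _ :=
  isUMagmaMorphism.Build G (Aut K) ext_act (ext_act1, ext_actM).

Lemma ext_act_in (k : K) : ext_act (iota k) = inner k.
Proof.
apply: aut_eqP => l; apply: (@ext_in_inj _ _ _ E).
by rewrite /= ext_conjE gmulfJ.
Qed.

Lemma ext_lift_exists (q : Q) : exists g : G, rho g = q.
Proof.
have := ext_pr_surj E => /(congr1 (fun A : set Q => A q)) /= qE.
by have : True by []; rewrite -[True]qE => -[g _ <-]; exists g.
Qed.
Definition ext_lift (q : Q) : G := sval (cid (ext_lift_exists q)).

Lemma ext_liftK : cancel ext_lift rho.
Proof. by move=> q; rewrite /ext_lift; case: cid. Qed.

(* By theta_pr, the value does not depend on the lift of q. *)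
Definition theta (q : Q) : Out K := out_class (ext_act (ext_lift q)).

Lemma theta_pr (g : G) : theta (rho g) = out_class (ext_act g).
Proof.
apply/out_classP.
have /ext_kerP[k kE] : rho ((ext_lift (rho g))^-1 * g) = 1.
  by rewrite gmulfM gmulfV ext_liftK mulVg.
by exists k => //; rewrite -ext_act_in kE gmulfM gmulfV.
Qed.

Lemma theta1 : theta 1 = 1.
Proof. by rewrite -[X in theta X](gmulf1 (s := rho)) theta_pr gmulf1. Qed.

Lemma thetaM : {morph theta : q r / q * r}.
Proof.
move=> q r; rewrite -(ext_liftK q) -(ext_liftK r) -gmulfM !theta_pr.
by rewrite !gmulfM.
Qed.

HB.instance Definition _ :=
  isUMagmaMorphism.Build Q (Out K) theta (theta1, thetaM).

End Extension.

(* Main.v *)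
Require Import Defs.
From mathcomp Require Import all_boot monoid.
From mathcomp Require Import boolp classical_sets functions cardinality.

(** The centralizer of [K] in [G] meets [K] in the center of [K], which is
    trivial, so [rho] is injective on it; and [theta (rho g) = 1] exactly when
    some element of [g K] centralizes [K].
    An element [u] of [FC G] centralizes [K]: for [k] in [K] the commutator
    [[~ u, k] = u^-1 * u ^ k] lies in [FC G] and in [K], hence is trivial.
    Then [rho u] lies in [FC Q] and in the kernel of [theta]. Conversely, an
    element of [FC Q] in the kernel of [theta] lifts to an element of [G]
    centralizing [K], whose conjugacy class is mapped injectively by [rho]
    into a finite one. *)

Set Implicit Arguments. Unset Strict Implicit. Unset Printing Implicit Defensive.
Local Open Scope classical_set_scope.
Local Open Scope group_scope.

Section FCSubgroup.
Variable H : groupType.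
Implicit Types x y : H.

Lemma FCP x : FC H x <-> finite_set (conj_class x).
Proof.
split=> [[_ [[y _ <-] fin_y] [h _ <-]]|fin_x]; last first.
  by exists (conj_class x); [split=> //; exists x | exists 1; rewrite ?conjg1].
by apply: sub_finite_set fin_y => _ [g _ <-]; exists (h * g); rewrite ?conjgM.
Qed.

Lemma FC1 : FC H 1.
Proof.
apply/FCP; apply: sub_finite_set (finite_set1 (1 : H)) => _ [h _ <-].
by rewrite conj1g.
Qed.

Lemma FCJ x y : FC H x -> FC H (x ^ y).
Proof.
move=> /FCP fin_x; apply/FCP; apply: sub_finite_set fin_x => _ [h _ <-].
by exists (y * h); rewrite ?conjgM.
Qed.

Lemma FCV x : FC H x -> FC H x^-1.
Proof.
move=> /FCP/(finite_image (fun y => y^-1)) fin_x; apply/FCP.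
apply: sub_finite_set fin_x => _ [h _ <-]; rewrite conjVg.
by exists (x ^ h) => //; exists h.
Qed.

(** A conjugate of [x * y] is a conjugate of [x] times a conjugate of [y], so only finitely many
    values occur. *)
Lemma FCM x y : FC H x -> FC H y -> FC H (x * y).
Proof.
move=> /FCP fin_x /FCP fin_y; apply/FCP.
apply: sub_finite_set (finite_image11 mul fin_x fin_y) => _ [h _ <-].
by exists h; rewrite ?conjMg.
Qed.

Lemma icc_FC_eq1 x : icc H -> FC H x -> x = 1.
Proof. by move=> [_ iccH] /FCP fin_x; apply: contrapT => /eqP/iccH. Qed.

Lemma icc_center_eq1 x : icc H -> (forall y, x ^ y = x) -> x = 1.
Proof.
move=> iccH cx; apply: icc_FC_eq1 => //; apply/FCP.
by apply: sub_finite_set (finite_set1 x) => _ [y _ <-] /=.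
Qed.

End FCSubgroup.

Section FCMorphism.
Variables (G H : groupType) (f : UMagmaMorphism.type G H).

Lemma conj_class_gmulf (x : G) :
  f @` conj_class x `<=` conj_class (f x).
Proof. by move=> _ [_ [g _ <-] <-]; exists (f g); rewrite ?gmulfJ. Qed.

Lemma FC_gmulf (x : G) : range f = setT -> FC G x -> FC H (f x).
Proof.
move=> f_surj /FCP/(finite_image f) fin_x; apply/FCP.
apply: sub_finite_set fin_x => _ [h _ <-].
have [g _ <-] : range f h by rewrite f_surj.
by rewrite -gmulfJ; exists (x ^ g) => //; exists g.
Qed.

Lemma FC_gmulf_inj (x : G) :
  {in conj_class x &, injective f} -> FC H (f x) -> FC G x.
Proof.
move=> f_inj /FCP fin_fx; apply/FCP.
rewrite -(eq_finite_set (inj_card_eq f_inj)).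
exact: sub_finite_set (@conj_class_gmulf x) fin_fx.
Qed.

End FCMorphism.

Section IccKernel.
Variables (K G Q : groupType) (E : extension K G Q) (iccK : icc K).
Local Notation iota := (ext_in E).
Local Notation rho := (ext_pr E).

Lemma ext_act_eq1P (g : G) :
  ext_act E g = 1 <-> forall k, iota k ^ g = iota k.
Proof.
split=> [g1 k|cg]; first by rewrite -ext_conjE -[ext_conj _ _ _]/(ext_act E g k) g1.
by apply: aut_eqP => k; apply: (@ext_in_inj _ _ _ E); rewrite /= ext_conjE.
Qed.

(** Since [iota k] acts on [K] as [inner k], a trivial action makes [k] central in [K]. *)
Lemma ext_cent_in_eq1 (k : K) : ext_act E (iota k) = 1 -> k = 1.
Proof.
rewrite ext_act_in => k1; apply: icc_center_eq1 => // l.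
by apply/conjg_fixP; rewrite commg1_sym; apply/conjg_fixP;
  rewrite -[l ^ k]/(inner k l) k1.
Qed.

(** The quotient [g^-1 * h] lies in [K] and still centralizes [K]. *)
Lemma ext_pr_cent_inj (g h : G) :
  ext_act E g = 1 -> ext_act E h = 1 -> rho g = rho h -> g = h.
Proof.
move=> g1 h1 gh.
have /ext_kerP[k kE] : rho (g^-1 * h) = 1 by rewrite gmulfM gmulfV gh mulVg.
have k1 : k = 1.
  by apply: ext_cent_in_eq1; rewrite kE gmulfM gmulfV /= g1 h1 mulVg.
by apply: (mulgI g^-1); rewrite mulVg -kE k1 gmulf1.
Qed.

Lemma theta_eq1P (q : Q) :
  theta E q = 1 <-> exists2 u, rho u = q & ext_act E u = 1.
Proof.
split=> [|[u <- u1]]; last by rewrite theta_pr u1.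
rewrite -(ext_liftK E q) theta_pr -[RHS]out_class1 => /esym/out_classP.
rewrite invg1 mul1g => -[k _ kE].
(* The lift acts as [inner k]; dividing by [iota k] cancels this action and keeps the image under
   [rho]. *)
exists (ext_lift E q * (iota k)^-1); last first.
  by rewrite gmulfM gmulfV /= ext_act_in kE mulgV.
have /ext_kerP k1 : exists l, iota l = iota k by exists k.
by rewrite gmulfM gmulfV k1 invg1 mulg1.
Qed.

Lemma FC_ext_in (k : K) : FC G (iota k) -> FC K k.
Proof. by apply: FC_gmulf_inj => x y _ _; exact: ext_in_inj. Qed.

Lemma FC_ext_act_eq1 (u : G) : FC G u -> ext_act E u = 1.
Proof.
move=> FCu; apply/ext_act_eq1P => k.
(* Commuting is symmetric, so the commutator may be taken as [u^-1 * u ^ iota k], a product of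
   elements of [FC G]. *)
apply/conjg_fixP; rewrite commg1_sym commgEl; apply/eqP.
have FCc : FC G (u^-1 * u ^ iota k) by apply: FCM; [exact: FCV | exact: FCJ].
have /ext_kerP[l lE] : rho (u^-1 * u ^ iota k) = 1.
  have /ext_kerP k1 : exists l, iota l = iota k by exists k.
  by rewrite gmulfM gmulfV gmulfJ k1 conjg1 mulVg.
move: FCc; rewrite -lE => /FC_ext_in/(icc_FC_eq1 iccK) ->.
exact: gmulf1.
Qed.

(** All conjugates of [u] act trivially on [K] too, so [rho] is injective on the whole class of
    [u]. *)
Lemma FC_cent_lift (u : G) : ext_act E u = 1 -> FC Q (rho u) -> FC G u.
Proof.
move=> u1; have uJ1 g : ext_act E (u ^ g) = 1 by rewrite gmulfJ /= u1 conj1g.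
apply: FC_gmulf_inj => _ _ /set_mem[g _ <-] /set_mem[h _ <-].
exact: ext_pr_cent_inj.
Qed.

End IccKernel.

Theorem theorem3 (K G Q : groupType) (E : extension K G Q) (hK : icc K) :
  icc G <-> set_inj (FC Q) (theta E).
Proof.
split=> [iccG p q /set_mem FCp /set_mem FCq pq | theta_inj].
  (* As [FC Q] is a subgroup, injectivity reduces to a trivial kernel. *)
  have FCpq : FC Q (p * q^-1) by apply: FCM => //; exact: FCV.
  have /theta_eq1P[u uE u1] : theta E (p * q^-1) = 1.
    by rewrite gmulfM gmulfV /= pq mulgV.
  have u_eq1 : u = 1.
    by apply: icc_FC_eq1 => //; apply: (FC_cent_lift hK u1); rewrite uE.
  by apply: (mulIg q^-1); rewrite mulgV -uE u_eq1 gmulf1.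
split.
  have [[k k_neq1] _] := hK; exists (ext_in E k).
  by rewrite gmulf_eq1 //; exact: ext_in_inj.
move=> u u_neq1 /FCP FCu; move/eqP: u_neq1; apply.
have u1 := FC_ext_act_eq1 E hK FCu.
(* Both [u] and [1] centralize [K], so it is enough to compare their images in [Q]. *)
apply: (ext_pr_cent_inj hK u1); first exact: gmulf1.
have rho_u : theta E (ext_pr E u) = theta E 1.
  by rewrite theta_pr u1 theta1.
rewrite gmulf1; apply: theta_inj rho_u; apply/mem_set; last exact: FC1.
exact: FC_gmulf (ext_pr_surj E) FCu.
Qed.
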